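(* Suppose $F$ is a discrete distribution supported on request types $(\mathbf a^1,r^1),\dots,(\mathbf a^n,r^n)$ with probabilities $p_1,\dots,p_n$, and let $\mathbf d\in\mathbb R^m_{\ge0}$. Suppose the optimal solution $\mathbf x^\star$ of the DLP (stated in the context) with right-hand side $\mathbf d$ is unique. Then the following four conditions (defined in the context) are equivalent: (1) discrete primal stability; (2) strict complementary slackness; (3) dual uniqueness; (4) DLP non-degeneracy.
   Context: Here $\mathbf a^j\in\mathbb R^m_{\ge0}$ are resource consumptions, $r^j\ge0$ rewards, $p_j>0$, $\sum_jp_j=1$. DLP with right-hand side $\mathbf d$: maximize $\sum_{j=1}^np_jr^jx_j$ subject to the resource constraints $\sum_{j=1}^n\mathbf a^jp_jx_j\le\mathbf d$ (componentwise, $m$ constraints) and $0\le x_j\le1$, $j=1,\dots,n$. Dual problem: $\min_{\boldsymbol\lambda\in\mathbb R^m_{\ge0}}f_{\mathbf d}(\boldsymbol\lambda)$, where $f_{\mathbf d}(\boldsymbol\lambda)=\mathbf d^\top\boldsymbol\lambda+\sum_{j=1}^np_j(r^j-(\mathbf a^j)^\top\boldsymbol\lambda)^+$. Its LP form is: minimize $\sum_{i=1}^md_i\lambda_i+\sum_{j=1}^n\eta_j$ subject to $\sum_{i=1}^ma_i^jp_j\lambda_i+\eta_j\ge p_jr^j$ for $j=1,\dots,n$ and $\boldsymbol\lambda,\boldsymbol\eta\ge0$. (1) Discrete primal stability: there exist an optimal solution $\mathbf x^\star_{\mathbf d}$ of the DLP and a neighborhood $\mathcal N(\mathbf d)$ of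 $\mathbf d$ such that for every $\mathbf d'\in\mathcal N(\mathbf d)$ there is an optimal solution $\mathbf x^\star_{\mathbf d'}$ of the DLP with right-hand side $\mathbf d'$ for which the set of all binding constraints (resource constraints and the constraints $0\le x_j$, $x_j\le 1$) is the same as that of $\mathbf x^\star_{\mathbf d}$. (2) Strict complementary slackness: the dual problem has a unique solution $\boldsymbol\lambda^\star$, and there is an optimal solution $\mathbf x^\star$ of the DLP such that strict complementary slackness holds between $\mathbf x^\star$ and the corresponding dual LP solution $(\boldsymbol\lambda^\star,\boldsymbol\eta^\star)$, $\eta^\star_j=p_j(r^j-(\mathbf a^j)^\top\boldsymbol\lambda^\star)^+$; i.e. in each complementary pair (resource slack $i$ and $\lambda^\star_i$; $1-x^\star_j$ and $\eta^\star_j$; $x^\star_j$ and the slack of the $j$-th dual constraint) exactly one of the two members is zero. (3) Dual uniqueness: the dual problem $\min_{\boldsymbol\lambda\ge0}f_{\mathbf d}(\boldsymbol\lambda)$ has a unique solution. (4) DLP non-degeneracy: the DLP has an optimal solution $\mathbf x^\star$ with $\big|\{j\in[n]:x^\star_j=0\text{ or }x^\star_j=1\}\big|+\big|\{i\in[m]:\sum_{j=1}^np_ja^j_ix^\star_j=d_i\}\big|=n$. *)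

(* Defs.v *)
From HB Require Import structures.
From mathcomp Require Import all_boot all_order all_algebra.
From mathcomp Require Import all_classical all_reals all_analysis.
Set Implicit Arguments.
Unset Strict Implicit.
Unset Printing Implicit Defensive.
Import Order.TTheory GRing.Theory Num.Theory.
Import numFieldNormedType.Exports.
Local Open Scope ring_scope.

Section DeterministicLP.
Context {R : realType} {m n : nat}.

(* Request type j consumes [a j i 0] units of resource i, pays the reward
   [r j] and arrives with probability [p j]. *)
Variables (a : 'I_n -> 'cV[R]_m) (r p : 'I_n -> R).

Implicit Types (d lambda : 'cV[R]_m) (x : 'cV[R]_n).

Definition dlp_objective x : R := \sum_j p j * r j * x j 0.

Definition dlp_usage x (i : 'I_m) : R := \sum_j a j i 0 * p j * x j 0.

Definition dlp_feasible d x : Prop :=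
  (forall i, dlp_usage x i <= d i 0) /\ (forall j, 0 <= x j 0 <= 1).

Definition dlp_optimal d x : Prop :=
  dlp_feasible d x /\
  forall y, dlp_feasible d y -> dlp_objective y <= dlp_objective x.

(* The index [inl (inl i)] stands for the i-th resource constraint,
   [inl (inr j)] for [0 <= x_j] and [inr j] for [x_j <= 1]. *)
Definition dlp_binding d x : {set 'I_m + 'I_n + 'I_n} :=
  [set c | match c with
           | inl (inl i) => dlp_usage x i == d i 0
           | inl (inr j) => x j 0 == 0
           | inr j => x j 0 == 1
           end]%SET.

Definition priced_cost lambda (j : 'I_n) : R := \sum_i a j i 0 * lambda i 0.

Definition dual_objective d lambda : R :=
  \sum_i d i 0 * lambda i 0 +
  \sum_j p j * Num.max (r j - priced_cost lambda j) 0.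

Definition dual_feasible lambda : Prop := forall i, 0 <= lambda i 0.

Definition dual_optimal d lambda : Prop :=
  dual_feasible lambda /\
  forall mu, dual_feasible mu -> dual_objective d lambda <= dual_objective d mu.

(* The dual LP: minimize [\sum_i d_i lambda_i + \sum_j eta_j] subject to
   [\sum_i a_i^j p_j lambda_i + eta_j >= p_j r^j] and [lambda, eta >= 0].
   [dual_eta lambda] is the eta-part attached to [lambda], and [dual_slack]
   is the slack of the j-th constraint at that point. *)
Definition dual_eta lambda (j : 'I_n) : R :=
  p j * Num.max (r j - priced_cost lambda j) 0.

Definition dual_slack lambda (j : 'I_n) : R :=
  \sum_i a j i 0 * p j * lambda i 0 + dual_eta lambda j - p j * r j.

(* [(+)] is exclusive or: exactly one member of each pair vanishes. *)
Definition strictly_complementary d x lambda : Prop :=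
  (forall i, (d i 0 - dlp_usage x i == 0) (+) (lambda i 0 == 0)) /\
  (forall j, (1 - x j 0 == 0) (+) (dual_eta lambda j == 0)) /\
  (forall j, (x j 0 == 0) (+) (dual_slack lambda j == 0)).

Definition discrete_primal_stability d : Prop :=
  exists x, dlp_optimal d x /\
    \forall d' \near d, exists x', dlp_optimal d' x' /\
      dlp_binding d' x' = dlp_binding d x.

Definition strict_complementary_slackness d : Prop :=
  exists lambda, unique (dual_optimal d) lambda /\
    exists x, dlp_optimal d x /\ strictly_complementary d x lambda.

Definition dual_uniqueness d : Prop := exists! lambda, dual_optimal d lambda.

Definition dlp_nondegeneracy d : Prop :=
  exists x, dlp_optimal d x /\
    addn #|[set j | (x j 0 == 0) || (x j 0 == 1)]%SET|
         #|[set i | dlp_usage x i == d i 0]%SET| = n.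

End DeterministicLP.

(* Main.v *)
Require Import Defs.
From HB Require Import structures.
From mathcomp Require Import all_boot all_order all_algebra.
From mathcomp Require Import all_classical all_reals all_analysis.
From mathcomp Require Import ring lra.
Set Implicit Arguments.
Unset Strict Implicit.
Unset Printing Implicit Defensive.
Import Order.TTheory GRing.Theory Num.Theory.
Import numFieldNormedType.Exports.
Local Open Scope ring_scope.

(** Write the DLP, with its resource and box constraints on the same footing,
    as: maximize [w . x] subject to [G c . x <= g c] for all [c] in a finite
    type. Each of the four conditions says, once the optimum [x] is unique,
    that the rows [G c] binding at [x] are linearly independent
    ([independent_binding] below).

    The bridge to the dual is the notion of multiplier: a nonnegative [y],
    supported on the binding rows, with [\sum_c y c *: G c = w]. By Farkas'
    lemma an optimal [x] has one ([optimal_multiplier]). In the DLP a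
    multiplier is determined by its resource part [lambda], the two box parts
    being the positive and negative parts of the reduced profit, and the
    vectors [lambda] obtained in this way are exactly the dual optima
    ([dlp_multiplierE], [dual_optimalE]).

    - Uniqueness of [x] makes the binding rows span the space
      ([unique_spanning]), so their independence amounts to there being [n]
      of them: this is non-degeneracy.
    - Independent binding rows leave room for one multiplier only. It is
      positive on every binding row: since [x] is unique, Farkas' lemma
      produces for each binding row some multiplier that is positive there
      ([unique_active_multiplier]). This is strict complementary slackness,
      which contains dual uniqueness.
    - If the multiplier is unique, it is positive on all binding rows, hence
      may be perturbed by a small multiple of any linear relation between
      them; by uniqueness that relation is trivial
      ([unique_multiplier_independent]).
    - If the binding set persists near [d], a relation [nu] between binding
      rows gives [\sum_c nu c * g c = 0] for all nearby right-hand sides, so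
      [nu] vanishes on resources, and then on bounds, since [0 <= x_j] and
      [x_j <= 1] do not bind together. Conversely, a family dual to
      independent binding rows moves [x] linearly with the right-hand side so
      that the binding rows stay binding; the other rows stay slack nearby,
      and an old multiplier certifies optimality. *)

(** * Dot products *)

Section DotProduct.
Variables (R : realFieldType) (n : nat).
Implicit Types u v w : 'cV[R]_n.

Definition dot u v : R := \sum_j u j 0 * v j 0.

Lemma dotC u v : dot u v = dot v u.
Proof. by apply: eq_bigr => j _; rewrite mulrC. Qed.

Lemma dotDl u v w : dot (u + v) w = dot u w + dot v w.
Proof. by rewrite -big_split; apply: eq_bigr => j _; rewrite !mxE mulrDl. Qed.

Lemma dotZl t u v : dot (t *: u) v = t * dot u v.
Proof. by rewrite mulr_sumr; apply: eq_bigr => j _; rewrite !mxE mulrA. Qed.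

Lemma dot0l v : dot 0 v = 0.
Proof. by rewrite -[X in dot X _](scale0r 0) dotZl mul0r. Qed.

Lemma dotNl u v : dot (- u) v = - dot u v.
Proof. by rewrite -scaleN1r dotZl mulN1r. Qed.

Lemma dotDr u v w : dot w (u + v) = dot w u + dot w v.
Proof. by rewrite dotC dotDl !(dotC w). Qed.

Lemma dotZr t u v : dot u (t *: v) = t * dot u v.
Proof. by rewrite dotC dotZl dotC. Qed.

Lemma dotNr u v : dot u (- v) = - dot u v.
Proof. by rewrite dotC dotNl dotC. Qed.

Lemma dot0r v : dot v 0 = 0.
Proof. by rewrite dotC dot0l. Qed.

Lemma dot_suml (I : finType) (F : I -> 'cV[R]_n) v :
  dot (\sum_i F i) v = \sum_i dot (F i) v.
Proof.
by apply: (big_morph (fun u => dot u v)) => [u1 u2|]; rewrite ?dotDl ?dot0l.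
Qed.

Lemma dot_sumr (I : finType) (F : I -> 'cV[R]_n) v :
  dot v (\sum_i F i) = \sum_i dot v (F i).
Proof. by rewrite dotC dot_suml; apply: eq_bigr => i _; rewrite dotC. Qed.

Lemma dot_self_gt0 v : v != 0 -> 0 < dot v v.
Proof.
move=> v0.
have sq_ge0 j : true -> 0 <= v j 0 * v j 0 by rewrite -expr2 sqr_ge0.
rewrite lt0r sumr_ge0 // andbT; apply: contra v0 => /eqP dvv.
apply/eqP/matrixP => j k; rewrite ord1 mxE.
have /eqP := psumr_eq0P sq_ge0 dvv (erefl true : xpredT j).
by rewrite -expr2 sqrf_eq0 => /eqP.
Qed.

End DotProduct.

(** * Farkas' lemma *)

Section Farkas.
Variables (R : realFieldType) (n : nat) (C : finType).

(** Induction on the generators. When the vector [h] separating [b] from the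
    remaining generators fails on the new one [v c0], the problem is projected
    along [v c0] onto the hyperplane orthogonal to [h]. *)
Lemma farkas_seq (s : seq C) (v : C -> 'cV[R]_n) (b : 'cV[R]_n) :
  (exists y : C -> R, [/\ forall c, 0 <= y c, forall c, c \notin s -> y c = 0
                        & \sum_c y c *: v c = b]) \/
  (exists h, (forall c, c \in s -> dot (v c) h <= 0) /\ 0 < dot b h).
Proof.
elim: s v b => [|c0 s IH] v b.
  have [->|b0] := eqVneq b 0.
    left; exists (fun=> 0); split=> //.
    by rewrite big1 // => c _; rewrite scale0r.
  by right; exists b; split=> //; exact: dot_self_gt0.
have extend (y : C -> R) t : (forall c, 0 <= y c) -> 0 <= t ->
    (forall c, c \notin s -> y c = 0) -> \sum_c y c *: v c + t *: v c0 = b ->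
    exists y : C -> R, [/\ forall c, 0 <= y c,
      forall c, c \notin c0 :: s -> y c = 0 & \sum_c y c *: v c = b].
  move=> y0 t0 ys yb; exists (fun c => y c + t * (c == c0)%:R); split=> [c|c|].
  - by rewrite addr_ge0 // mulr_ge0.
  - rewrite inE negb_or => /andP[/negPf -> /ys ->].
    by rewrite mulr0 addr0.
  - rewrite -yb (eq_bigr _ (fun c _ => scalerDl _ _ _)) big_split /=.
    congr (_ + _); rewrite (bigD1 c0) //= eqxx mulr1 big1 ?addr0 // => c.
    by move=> /negPf ->; rewrite mulr0 scale0r.
have [[y [y0 ys yb]]|[h [hs hb]]] := IH v b.
  by left; apply: (extend y 0) => //; rewrite scale0r addr0.
have [hc0|hc0] := leP (dot (v c0) h) 0.
  right; exists h; split=> // c; rewrite inE => /predU1P[-> //|]; exact: hs.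
(* [proj] is the projection along [v c0] onto the orthogonal of [h]. *)
pose proj u := u - (dot u h / dot (v c0) h) *: v c0.
have [[y [y0 ys yb]]|[h' [hs' hb']]] := IH (proj \o v) (proj b).
  left; apply: (extend y (dot b h / dot (v c0) h -
      \sum_c y c * (dot (v c) h / dot (v c0) h))) => //.
    rewrite subr_ge0; apply: (@le_trans _ _ 0); last by rewrite divr_ge0 // ltW.
    apply: sumr_le0 => c _.
    have [cs|/ys ->] := boolP (c \in s); last by rewrite mul0r.
    apply: mulr_ge0_le0 => //; apply: mulr_le0_ge0; first exact: hs.
    by rewrite invr_ge0 ltW.
  have : \sum_c y c *: v c =
    proj b + (\sum_c y c * (dot (v c) h / dot (v c0) h)) *: v c0.
    rewrite -yb scaler_suml -big_split; apply: eq_bigr => c _ /=.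
    by rewrite scalerBr scalerA subrK.
  by move=> ->; rewrite scalerBl addrCA addrK addrC subrK.
(* Subtracting this multiple of [h] makes the new vector orthogonal to
   [v c0], and pairing with it is pairing with [h'] after [proj]. *)
right; exists (h' - (dot (v c0) h' / dot (v c0) h) *: h).
have shift u :
    dot u (h' - (dot (v c0) h' / dot (v c0) h) *: h) = dot (proj u) h'.
  rewrite dotDr dotNr dotZr dotDl dotNl dotZl.
  by rewrite mulrAC [in RHS]mulrAC (mulrC (dot u h)).
split=> [c|]; rewrite shift //.
rewrite inE => /predU1P[->|]; last exact: hs'.
by rewrite /proj divff ?gt_eqF // scale1r subrr dot0l.
Qed.

Lemma farkas (A : {set C}) (v : C -> 'cV[R]_n) (b : 'cV[R]_n) :
  (exists y : C -> R, [/\ forall c, 0 <= y c, forall c, c \notin A -> y c = 0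
                        & \sum_c y c *: v c = b]) \/
  (exists h, (forall c, c \in A -> dot (v c) h <= 0) /\ 0 < dot b h).
Proof.
have [[y [y0 yA yb]]|[h [hA hb]]] := farkas_seq (enum A) v b.
  by left; exists y; split=> // c cA; rewrite yA // mem_enum.
by right; exists h; split=> // c cA; rewrite hA // mem_enum.
Qed.

(** A step in direction [t] that does not leave a region: [s] will be the
    slacks of a feasible point, the coordinates of a multiplier, or a radius.
    The step [1 / (1 + \sum_c `|t c| / s c)] avoids a minimum over a possibly
    empty family; the terms with [s c = 0] contribute zero to it. *)
Lemma small_step (s t : C -> R) : (forall c, 0 <= s c) ->
  (forall c, s c = 0 -> t c <= 0) -> exists2 e, 0 < e & forall c, e * t c <= s c.
Proof.
move=> s0 t0; pose S := \sum_c `|t c| / s c.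
have term_ge0 c : 0 <= `|t c| / s c by rewrite divr_ge0.
have S1 : 0 < 1 + S by rewrite ltr_pwDl // sumr_ge0.
exists (1 + S)^-1; first by rewrite invr_gt0.
move=> c; rewrite mulrC ler_pdivrMr //.
have [sc0|sc] := eqVneq (s c) 0; first by rewrite sc0 mul0r t0.
have sc_gt0 : 0 < s c by rewrite lt0r sc s0.
rewrite mulrC -ler_pdivrMr //; apply: (@le_trans _ _ (`|t c| / s c)).
  by rewrite ler_pM2r ?invr_gt0 // ler_norm.
rewrite /S (bigD1 c) //=.
by rewrite addrCA lerDl addr_ge0 // sumr_ge0.
Qed.

End Farkas.

(** * Independent and spanning families of rows *)

Section RowFamilies.
Variables (R : realFieldType) (n : nat) (C : finType) (G : C -> 'cV[R]_n).
Implicit Types (A : {set C}).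

(** The rows are indexed rather than collected in a set, so that equal rows
    with different indices count as dependent. *)
Definition independent_on A := forall nu : C -> R,
  (forall c, c \notin A -> nu c = 0) -> \sum_c nu c *: G c = 0 ->
  forall c, nu c = 0.

Definition spanning_on A := forall h,
  (forall c, c \in A -> dot (G c) h = 0) -> h = 0.

Definition row_matrix A : 'M[R]_(#|A|, n) :=
  \matrix_(k, j) G (enum_val k) j 0.

Lemma independent_row_free A : independent_on A <-> row_free (row_matrix A).
Proof.
split=> [indep|free nu nuA nuG].
  apply: inj_row_free => v vM.
  pose nu c := \sum_k v 0 k * (enum_val k == c)%:R.
  have nuA c : c \notin A -> nu c = 0.
    move=> cA; rewrite /nu big1 // => k _.
    case: eqP cA => [<-|]; last by rewrite mulr0.
    by rewrite enum_valP.
  have nuG : \sum_c nu c *: G c = 0.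
    apply/matrixP => j l; rewrite ord1 summxE mxE.
    transitivity ((v *m row_matrix A) 0 j); last by rewrite vM mxE.
    rewrite mxE; under eq_bigr => c _ do rewrite mxE mulr_suml.
    rewrite exchange_big; apply: eq_bigr => k _ /=.
    rewrite (bigD1 (enum_val k)) //= eqxx mulr1 mxE big1 ?addr0 // => c.
    by rewrite eq_sym => /negPf ->; rewrite mulr0 mul0r.
  apply/matrixP => i k; rewrite ord1 mxE -(indep nu nuA nuG (enum_val k)) /nu.
  rewrite (bigD1 k) //= eqxx mulr1 big1 ?addr0 // => k' k'k.
  by rewrite (inj_eq enum_val_inj) (negPf k'k) mulr0.
have nu0 : \row_(k < #|A|) nu (enum_val k) = 0.
  apply: (row_free_inj free); rewrite mul0mx; apply/matrixP => i j.
  rewrite !mxE -[RHS](_ : (\sum_c nu c *: G c) j 0 = 0); last by rewrite nuG mxE.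
  rewrite summxE; under eq_bigr => k _ do rewrite !mxE.
  rewrite -(big_enum_val (fun c => nu c * G c j 0)) big_mkcond.
  by apply: eq_bigr => c _; rewrite mxE; case: ifPn => // /nuA ->; rewrite mul0r.
move=> c; have [cA|/nuA //] := boolP (c \in A).
have /matrixP/(_ 0 (enum_rank_in cA c)) := nu0.
by rewrite !mxE enum_rankK_in.
Qed.

Lemma spanning_rank A : spanning_on A -> \rank (row_matrix A) = n.
Proof.
move=> span; rewrite -mxrank_tr; apply/eqP; apply: inj_row_free => v vM.
rewrite -[v]trmxK -[RHS]trmx0; congr (_^T); apply: span => c cA.
have /matrixP/(_ 0 (enum_rank_in cA c)) := vM; rewrite !mxE => <-.
by apply: eq_bigr => j _; rewrite !mxE enum_rankK_in // mulrC.
Qed.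

Lemma independent_card A : spanning_on A -> independent_on A <-> #|A| = n.
Proof.
move=> /spanning_rank rk; rewrite independent_row_free /row_free rk.
by split=> [/eqP|->].
Qed.

(** A right inverse of the row matrix. For [c0] outside [A] the zero vector
    fits the same formula, which lets later sums range over all indices. *)
Lemma dual_vector A c0 : independent_on A ->
  exists u, forall c, c \in A -> dot (G c) u = (c == c0)%:R.
Proof.
move=> /independent_row_free /mulmxVp free.
have [c0A|c0A] := boolP (c0 \in A); last first.
  by exists 0 => c cA; rewrite dot0r; case: eqP cA c0A => // -> ->.
exists (col (enum_rank_in c0A c0) (pinvmx (row_matrix A))) => c cA.
have /matrixP/(_ (enum_rank_in c0A c) (enum_rank_in c0A c0)) := free.
rewrite !mxE; have -> : (enum_rank_in c0A c == enum_rank_in c0A c0) = (c == c0).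
  by rewrite -(inj_eq enum_val_inj) !enum_rankK_in.
by move=> <-; apply: eq_bigr => j _; rewrite !mxE enum_rankK_in.
Qed.

End RowFamilies.

(** * Linear programs, multipliers and unique optima *)

Section LinearProgram.
Variables (R : realFieldType) (n : nat) (C : finType).
Variables (G : C -> 'cV[R]_n) (g : C -> R) (w : 'cV[R]_n).
Implicit Types (x h : 'cV[R]_n) (y : C -> R).

Definition lp_feasible x := forall c, dot (G c) x <= g c.

Definition lp_optimal x :=
  lp_feasible x /\ forall x', lp_feasible x' -> dot w x' <= dot w x.

Definition active x : {set C} := [set c | dot (G c) x == g c]%SET.

(** The Karush-Kuhn-Tucker conditions at [x]. *)
Definition multiplier x y :=
  [/\ forall c, 0 <= y c, forall c, c \notin active x -> y c = 0
    & \sum_c y c *: G c = w].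

(** The duality gap is the total of the complementarity products; weak
    duality, optimality of points with a multiplier and complementary
    slackness are read off from it. *)
Lemma dual_value y x : \sum_c y c *: G c = w ->
  \sum_c y c * g c - dot w x = \sum_c y c * (g c - dot (G c) x).
Proof.
move=> <-; rewrite dot_suml -sumrB; apply: eq_bigr => c _.
by rewrite dotZl mulrBr.
Qed.

Lemma multiplier_value x y : multiplier x y -> \sum_c y c * g c = dot w x.
Proof.
move=> [_ ys yw]; apply/eqP; rewrite -subr_eq0 dual_value // big1 // => c _.
have [|/ys ->] := boolP (c \in active x); last by rewrite mul0r.
by rewrite inE => /eqP ->; rewrite subrr mulr0.
Qed.

Lemma weak_duality y x : (forall c, 0 <= y c) -> \sum_c y c *: G c = w ->
  lp_feasible x -> dot w x <= \sum_c y c * g c.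
Proof.
move=> y0 yw fx; rewrite -subr_ge0 dual_value // sumr_ge0 // => c _.
by rewrite mulr_ge0 // subr_ge0.
Qed.

Lemma multiplier_optimal x y :
  lp_feasible x -> multiplier x y -> lp_optimal x.
Proof.
move=> fx my; split=> // x' fx'; rewrite -(multiplier_value my).
by case: my => y0 _ yw; exact: weak_duality.
Qed.

Lemma complementary_slackness x y : lp_feasible x -> (forall c, 0 <= y c) ->
  \sum_c y c *: G c = w -> \sum_c y c * g c <= dot w x -> multiplier x y.
Proof.
move=> fx y0 yw; rewrite -subr_le0 dual_value // => gap; split=> // c cx.
have term_ge0 c' : true -> 0 <= y c' * (g c' - dot (G c') x).
  by rewrite mulr_ge0 // subr_ge0.
have gap0 : \sum_c y c * (g c - dot (G c) x) = 0.
  by apply/eqP; rewrite eq_le gap sumr_ge0.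
have /eqP := psumr_eq0P term_ge0 gap0 (erefl true : xpredT c).
by rewrite mulf_eq0 subr_eq0 => /orP[/eqP //|/eqP gc]; rewrite inE gc eqxx in cx.
Qed.

Lemma feasible_direction x h : lp_feasible x ->
  (forall c, c \in active x -> dot (G c) h <= 0) ->
  exists2 e, 0 < e & lp_feasible (x + e *: h).
Proof.
move=> fx hx; have [||e e0 he] := @small_step R C (fun c => g c - dot (G c) x)
  (fun c => dot (G c) h).
- by move=> c; rewrite subr_ge0.
- by move=> c gc; apply: hx; rewrite inE -subr_eq0 -oppr_eq0 opprB gc.
exists e => // c; rewrite dotDr dotZr addrC -lerBrDr; exact: he.
Qed.

(** Otherwise Farkas' lemma gives a direction that is feasible at [x] and
    improves the objective. *)
Lemma optimal_multiplier x : lp_optimal x -> exists y, multiplier x y.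
Proof.
move=> [fx ox]; have [[y ?]|[h [hx hw]]] := farkas (active x) G w.
  by exists y.
have [e e0 /ox] := feasible_direction fx hx.
by rewrite dotDr dotZr gerDl leNgt mulr_gt0.
Qed.

Section UniqueOptimum.
Variable x : 'cV[R]_n.
Hypothesis x_unique : unique lp_optimal x.

Let fx : lp_feasible x. Proof. by case: x_unique => -[]. Qed.

(** A nonworsening feasible direction leads to further optimal points. *)
Lemma unique_no_direction h :
  (forall c, c \in active x -> dot (G c) h <= 0) -> 0 <= dot w h -> h = 0.
Proof.
case: x_unique => -[_ ox] ux hx hw.
have [e e0 fe] := feasible_direction fx hx.
have /ux/eqP : lp_optimal (x + e *: h).
  split=> // x' /ox /le_trans; apply.
  by rewrite dotDr dotZr lerDl mulr_ge0 // ltW.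
rewrite -subr_eq0 opprD addrA subrr sub0r oppr_eq0 scaler_eq0.
by rewrite gt_eqF // => /eqP.
Qed.

(** A vector [h] orthogonal to all binding rows can be followed in both
    senses, and one of [h], [- h] does not worsen the objective. *)
Lemma unique_spanning : spanning_on G (active x).
Proof.
move=> h hx; have [hw|/ltW hw] := leP 0 (dot w h).
  by apply: unique_no_direction => // c /hx ->.
apply/eqP; rewrite -oppr_eq0; apply/eqP; apply: unique_no_direction.
  by move=> c /hx; rewrite dotNr => ->; rewrite oppr0.
by rewrite dotNr oppr_ge0.
Qed.

(** No feasible direction [h] with [0 <= dot w h] has [dot (G c0) h < 0], so
    Farkas' lemma writes [- G c0] as a nonnegative combination of the binding
    rows and [- w]. This rearranges to
    [G c0 + \sum_c z c *: G c = t *: w], and adding the identity of any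
    multiplier and dividing by [1 + t] gives a multiplier positive at [c0]. *)
Lemma unique_active_multiplier c0 : c0 \in active x ->
  exists2 y, multiplier x y & 0 < y c0.
Proof.
move=> c0x; have [y [y0 ys yw]] := optimal_multiplier x_unique.1.
(* The extra generator [- w] is the one indexed by [unit]. *)
pose v (o : unit + C) := match o with inl _ => - w | inr c => G c end.
pose A : {set unit + C} :=
  [set o | match o with inl _ => true | inr c => c \in active x end]%SET.
have [[z [z0 zs zG]]|[h [hA hc0]]] := farkas A v (- G c0); last first.
  suff h0 : h = 0 by rewrite h0 dot0r ltxx in hc0.
  apply: unique_no_direction => [c cx|].
    by apply: (hA (inr c)); rewrite inE.
  by have := hA (inl tt); rewrite inE dotNl oppr_le0; apply.
have {}zG : \sum_c z (inr c) *: G c + G c0 = z (inl tt) *: w.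
  move: zG; rewrite big_sumType /= (bigD1 tt) //= big1 => [|[]//].
  rewrite addr0 scalerN addrC => /(canRL (subrK _)) ->.
  by rewrite addrAC addNr add0r.
have t0 : 0 < 1 + z (inl tt) by rewrite ltr_pwDl.
exists (fun c => (y c + z (inr c) + (c == c0)%:R) / (1 + z (inl tt))); last first.
  by rewrite divr_gt0 // eqxx ltr_wpDl // addr_ge0.
split=> [c|c cx|].
- by rewrite divr_ge0 ?addr_ge0 // ltW.
- have /negPf -> : c != c0 by apply: contraNneq cx => ->.
  have -> : z (inr c) = 0 by apply: zs; rewrite finset.in_set.
  by rewrite ys // !addr0 mul0r.
transitivity ((1 + z (inl tt))^-1 *: (w + (\sum_c z (inr c) *: G c + G c0))).
  rewrite -yw addrA -big_split scalerDr !scaler_sumr /=.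
  rewrite [X in _ = _ + X](_ : _ =
    \sum_c ((c == c0)%:R / (1 + z (inl tt))) *: G c).
    rewrite -big_split; apply: eq_bigr => c _ /=.
    by rewrite -scalerDl scalerA -scalerDl; congr (_ *: _); ring.
  rewrite (bigD1 c0) //= eqxx mul1r big1 ?addr0 // => c /negPf ->.
  by rewrite mul0r scale0r.
by rewrite zG -{1}[w]scale1r -scalerDl scalerA mulVf ?scale1r // gt_eqF.
Qed.

Lemma independent_multiplier y y' : independent_on G (active x) ->
  multiplier x y -> multiplier x y' -> y =1 y'.
Proof.
move=> indep [_ ys yw] [_ ys' yw'] c; apply/eqP; rewrite -subr_eq0; apply/eqP.
apply: (indep (fun c => y c - y' c)) => [{}c cx|].
  by rewrite ys // ys' // subrr.
by under eq_bigr => ? _ do rewrite scalerBl; rewrite sumrB yw yw' subrr.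
Qed.

Lemma unique_multiplier_gt0 y :
  (forall y', multiplier x y' -> y' =1 y) ->
  forall c, c \in active x -> 0 < y c.
Proof.
by move=> uy c /unique_active_multiplier[y' /uy <-].
Qed.

(** The unique multiplier is positive on the binding rows, so it stays
    nonnegative when a small multiple of a relation [nu] between these rows is
    added; the sum is again a multiplier, hence [nu] is zero. *)
Lemma unique_multiplier_independent y :
  multiplier x y -> (forall y', multiplier x y' -> y' =1 y) ->
  independent_on G (active x).
Proof.
move=> [y0 ys yw] uy nu nus nuG c.
have [//|c'|e e0 he] := @small_step R C y (fun c => - nu c).
  have [/(unique_multiplier_gt0 uy)|/nus ->] := boolP (c' \in active x).
    by move=> /gt_eqF/eqP.
  by rewrite oppr0.
have /uy/(_ c)/eqP : multiplier x (fun c => y c + e * nu c).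
  split=> [c'|c' c'x|].
  - by have := he c'; rewrite mulrN lerNl -subr_ge0 opprK addrC.
  - by rewrite ys // nus // mulr0 addr0.
  transitivity (\sum_c y c *: G c + e *: (\sum_c nu c *: G c)).
    rewrite scaler_sumr -big_split.
    by apply: eq_bigr => c' _; rewrite scalerDl scalerA.
  by rewrite nuG scaler0 addr0.
by rewrite -subr_eq0 addrAC subrr add0r mulf_eq0 gt_eqF //= => /eqP.
Qed.

End UniqueOptimum.

End LinearProgram.

(** * Small perturbations of the right-hand side *)

Section Neighborhoods.
Variables (R : realType) (m : nat) (d : 'cV[R]_m).

Lemma near_ray (P : 'cV[R]_m -> Prop) (u : 'cV[R]_m) :
  (\forall d' \near d, P d') -> exists2 e, 0 < e & P (d + e *: u).
Proof.
move=> /nbhs_ballP[e /= e0 dP].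
have [||t t0 tu] := @small_step R 'I_m (fun=> e / 2) (fun i => `|u i 0|).
- by move=> _; rewrite divr_ge0 // ltW.
- by move=> c /eqP; rewrite mulf_eq0 invr_eq0 gt_eqF //= pnatr_eq0.
exists t => //; apply: dP; split=> // i j; rewrite ord1 /ball /= !mxE.
rewrite opprD addrA subrr sub0r normrN normrM gtr0_norm //.
by apply: le_lt_trans (tu i) _; rewrite ltr_pdivrMr // mulr_natr mulr2n ltrDl.
Qed.

Lemma near_affine_gt0 (K : R) (k : 'I_m -> R) : 0 < K ->
  \forall d' \near d, 0 < K + \sum_i ((d' : 'cV[R]_m) i 0 - d i 0) * k i.
Proof.
move=> K0; apply: (@cvgr_gt _ _ (nbhs d) _ _ K) => //.
rewrite -[X in (_ --> X)%classic]addr0; apply: cvgD; first exact: cvg_cst.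
rewrite -[X in (_ --> X)%classic]
  (@big1 R 0 +%R 'I_m (index_enum _) xpredT (fun=> 0)) //.
apply: cvg_big => [|i _]; first exact: add_continuous.
rewrite -[X in (_ --> X)%classic](mul0r (k i)); apply: cvgM; last exact: cvg_cst.
rewrite -[X in (_ --> X)%classic](subrr (d i 0)); apply: cvgB; last exact: cvg_cst.
exact: coord_continuous.
Qed.

End Neighborhoods.

(** * The deterministic linear program *)

Section DLP.
Variables (R : realType) (m n : nat).
Variables (a : 'I_n -> 'cV[R]_m) (r p : 'I_n -> R).
Hypothesis p_gt0 : forall j, 0 < p j.
Implicit Types (d lambda : 'cV[R]_m) (x : 'cV[R]_n).

Definition dlp_row (c : 'I_m + 'I_n + 'I_n) : 'cV[R]_n :=
  match c with
  | inl (inl i) => \col_j (a j i 0 * p j)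
  | inl (inr j) => - delta_mx j 0
  | inr j => delta_mx j 0
  end.

Definition dlp_rhs d (c : 'I_m + 'I_n + 'I_n) : R :=
  match c with inl (inl i) => d i 0 | inl (inr j) => 0 | inr j => 1 end.

Definition dlp_cost : 'cV[R]_n := \col_j (p j * r j).

Lemma dot_delta j x : dot (delta_mx j 0) x = x j 0.
Proof.
rewrite /dot (bigD1 j) //= mxE !eqxx mul1r big1 ?addr0 // => k kj.
by rewrite mxE (negPf kj) mul0r.
Qed.

Lemma dot_resource i x : dot (dlp_row (inl (inl i))) x = dlp_usage a p x i.
Proof. by apply: eq_bigr => j _; rewrite mxE. Qed.

Lemma dot_lower j x : dot (dlp_row (inl (inr j))) x = - x j 0.
Proof. by rewrite /= dotNl dot_delta. Qed.

Lemma dot_upper j x : dot (dlp_row (inr j)) x = x j 0.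
Proof. exact: dot_delta. Qed.

Lemma dot_cost x : dot dlp_cost x = dlp_objective r p x.
Proof. by apply: eq_bigr => j _; rewrite mxE. Qed.

Lemma dlp_feasibleE d x :
  dlp_feasible a p d x <-> lp_feasible dlp_row (dlp_rhs d) x.
Proof.
split=> [[xd x01] [[i|j]|j]|fx].
- by rewrite dot_resource; exact: xd.
- by rewrite dot_lower /= oppr_le0; case/andP: (x01 j).
- by rewrite dot_upper /=; case/andP: (x01 j).
split=> [i|j]; first by have := fx (inl (inl i)); rewrite dot_resource.
have := fx (inr j); have := fx (inl (inr j)).
by rewrite dot_lower dot_upper /= oppr_le0 => -> ->.
Qed.

Lemma dlp_optimalE d x :
  dlp_optimal a r p d x <-> lp_optimal dlp_row (dlp_rhs d) dlp_cost x.
Proof.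
split=> -[/dlp_feasibleE fx ox]; split=> // y /dlp_feasibleE /ox;
  by rewrite !dot_cost.
Qed.

Lemma dlp_bindingE d x : dlp_binding a p d x = active dlp_row (dlp_rhs d) x.
Proof.
apply/setP => c; rewrite !finset.in_set; case: c => [[i|j]|j] //=.
- by rewrite -dot_resource.
- by rewrite (dot_lower j) oppr_eq0.
- by rewrite (dot_upper j).
Qed.

(** Slack and [dual_eta] are thus, up to the factor [p j], the negative and
    positive parts of the reduced profit [r j - priced_cost a lambda j]. *)
Lemma dual_slackE lambda j :
  dual_slack a r p lambda j = p j * Num.max (priced_cost a lambda j - r j) 0.
Proof.
rewrite /dual_slack /dual_eta.
have -> : \sum_i a j i 0 * p j * lambda i 0 = p j * priced_cost a lambda j.
  by rewrite mulr_sumr; apply: eq_bigr => i _; rewrite mulrAC mulrC.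
rewrite -mulrDr -mulrBr; congr (_ * _); set q := priced_cost a lambda j.
by rewrite /Num.max; case: ltrP => ?; case: ltrP => ?; lra.
Qed.

(** The point of the dual LP attached to [lambda], with the dual slacks as
    multipliers of the constraints [0 <= x_j]. *)
Definition dlp_multiplier lambda (c : 'I_m + 'I_n + 'I_n) : R :=
  match c with
  | inl (inl i) => lambda i 0
  | inl (inr j) => dual_slack a r p lambda j
  | inr j => dual_eta a r p lambda j
  end.

Lemma dlp_multiplier_ge0 lambda :
  dual_feasible lambda -> forall c, 0 <= dlp_multiplier lambda c.
Proof.
move=> l0 [[i|j]|j] /=; first exact: l0.
  by rewrite dual_slackE mulr_ge0 ?(ltW (p_gt0 j)) // le_max lexx orbT.
by rewrite mulr_ge0 ?(ltW (p_gt0 j)) // le_max lexx orbT.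
Qed.

Lemma dlp_combinationE (y : 'I_m + 'I_n + 'I_n -> R) j :
  (\sum_c y c *: dlp_row c) j 0 =
  \sum_i a j i 0 * p j * y (inl (inl i)) - y (inl (inr j)) + y (inr j).
Proof.
have pick (z : 'I_n -> R) : \sum_k z k * (j == k)%:R = z j.
  rewrite (bigD1 j) //= eqxx mulr1 big1 ?addr0 // => k.
  by rewrite eq_sym => /negPf ->; rewrite mulr0.
rewrite summxE !big_sumType /=; congr (_ + _ + _).
- by apply: eq_bigr => i _; rewrite !mxE mulrC.
- rewrite -(pick (fun k => y (inl (inr k)))) -sumrN.
  by apply: eq_bigr => k _; rewrite !mxE andbT mulrN.
- rewrite -(pick (fun k => y (inr k))).
  by apply: eq_bigr => k _; rewrite !mxE andbT.
Qed.

Lemma dlp_multiplier_combination lambda :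
  \sum_c dlp_multiplier lambda c *: dlp_row c = dlp_cost.
Proof.
apply/matrixP => j k; rewrite ord1 dlp_combinationE mxE /= /dual_slack.
by rewrite opprB opprD addrA; ring.
Qed.

Lemma dlp_multiplier_value d lambda :
  \sum_c dlp_multiplier lambda c * dlp_rhs d c = dual_objective a r p d lambda.
Proof.
rewrite !big_sumType /= [X in _ + X + _]big1 ?addr0 => [|j _]; last first.
  by rewrite mulr0.
by congr (_ + _); apply: eq_bigr => i _; rewrite ?mulr1 // mulrC.
Qed.

(** The two box multipliers of [j] have the reduced profit as difference and
    (up to the factor [p j]) and cannot both be nonzero, as [x_j] is not both 0 and 1; hence they are its
    positive and negative parts. *)
Lemma dlp_multiplierE d x y : multiplier dlp_row (dlp_rhs d) dlp_cost x y ->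
  y =1 dlp_multiplier (\col_i y (inl (inl i))).
Proof.
move=> [y0 ys yw]; set lambda := \col_i _.
have balance j : p j * (priced_cost a lambda j - r j) =
    y (inl (inr j)) - y (inr j).
  have /matrixP/(_ j 0) := yw; rewrite dlp_combinationE mxE => E.
  rewrite mulrBr -E mulr_sumr.
  under eq_bigr => i _ do rewrite mxE mulrCA mulrA.
  by ring.
have compl j : y (inl (inr j)) = 0 \/ y (inr j) = 0.
  have [/eqP|] := boolP (inr j \in active dlp_row (dlp_rhs d) x); last first.
    by move=> /ys; right.
  rewrite eqb_id finset.in_set dot_upper => /eqP xj; left; apply: ys.
  by rewrite finset.in_set dot_lower /= xj oppr_eq0 oner_eq0.
have pmax j (t : R) : p j * Num.max t 0 = Num.max (p j * t) 0.
  by rewrite maxr_pMr ?ltW // mulr0.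
move=> [[i|j]|j] /=; first by rewrite mxE.
  rewrite dual_slackE pmax balance.
  have := y0 (inl (inr j)); have := y0 (inr j).
  by case: (compl j) => ->; move=> ? ?; rewrite /Num.max; case: ltrP => ?; lra.
rewrite /dual_eta pmax -opprB mulrN balance opprB.
have := y0 (inl (inr j)); have := y0 (inr j).
by case: (compl j) => ->; move=> ? ?; rewrite /Num.max; case: ltrP => ?; lra.
Qed.

(** Some multiplier exists at [x], and by duality it makes the optimal value
    of the dual equal to the primal one; every other dual optimum then has
    zero duality gap, which is complementary slackness. *)
Lemma dual_optimalE d x lambda : dlp_optimal a r p d x ->
  dual_optimal a r p d lambda <->
  multiplier dlp_row (dlp_rhs d) dlp_cost x (dlp_multiplier lambda).
Proof.
move=> /dlp_optimalE ox; have fx := ox.1; split=> [[l0 ol]|ml].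
  have [y my] := optimal_multiplier ox.
  apply: complementary_slackness => //.
  - exact: dlp_multiplier_ge0.
  - exact: dlp_multiplier_combination.
  rewrite -(multiplier_value my) dlp_multiplier_value.
  under [leRHS]eq_bigr => c _ do rewrite (dlp_multiplierE my).
  rewrite dlp_multiplier_value; apply: ol => i; rewrite mxE.
  by case: my.
split=> [i|mu mu0]; first by case: ml => /(_ (inl (inl i))).
rewrite -!dlp_multiplier_value (multiplier_value ml); apply: weak_duality => //.
  exact: dlp_multiplier_ge0.
exact: dlp_multiplier_combination.
Qed.

Section UniqueOptimum.
Variables (d : 'cV[R]_m) (x : 'cV[R]_n).
Hypothesis x_unique : unique (dlp_optimal a r p d) x.

Let ox : dlp_optimal a r p d x. Proof. by case: x_unique. Qed.

Let lp_unique : unique (lp_optimal dlp_row (dlp_rhs d) dlp_cost) x.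
Proof.
by split=> [|y /dlp_optimalE]; [exact/dlp_optimalE|exact: x_unique.2].
Qed.

(** The constraint qualification to which all four conditions reduce. *)
Definition independent_binding := independent_on dlp_row (dlp_binding a p d x).

(** Evaluating a relation [nu] at a point with the same binding set shows that
    [nu] is orthogonal to the right-hand side; comparing [d] with
    [d + e *: u], where [u] is the resource part of [nu], gives
    [e * dot u u = 0]. *)
Lemma primal_stability_independent_binding :
  discrete_primal_stability a r p d -> independent_binding.
Proof.
move=> [x1 [/x_unique.2 <- stable]] nu nus nuG.
have nu_rhs d' x' : dlp_binding a p d' x' = dlp_binding a p d x ->
    \sum_c nu c * dlp_rhs d' c = 0.
  move=> bx'; transitivity (dot (\sum_c nu c *: dlp_row c) x').
    2: by rewrite nuG dot0l.
  rewrite dot_suml; apply: eq_bigr => c _.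
  rewrite dotZl; have [|/nus ->] := boolP (c \in dlp_binding a p d x).
    by rewrite -bx' dlp_bindingE finset.in_set => /eqP ->.
  by rewrite !mul0r.
pose u : 'cV[R]_m := \col_i nu (inl (inl i)).
have [e e0 [x' [_ /nu_rhs]]] := near_ray u stable.
have := nu_rhs d x erefl; rewrite !big_sumType /= => nu_d nu_d'.
have : e * dot u u = 0.
  have /addIr/addIr/eqP := etrans nu_d' (esym nu_d).
  under eq_bigr => i _ do rewrite !mxE mulrDr.
  rewrite big_split /= addrC -subr_eq0 addrK => /eqP <-.
  rewrite mulr_sumr.
  by apply: eq_bigr => i _; rewrite !mxE mulrCA.
move=> /eqP; rewrite mulf_eq0 gt_eqF //= => uu0.
have /eqP u0 : u == 0.
  by apply: contraTT uu0 => /dot_self_gt0 /gt_eqF ->.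
have nu0 i : nu (inl (inl i)) = 0 by have /matrixP/(_ i 0) := u0; rewrite !mxE.
have nuj j : nu (inl (inr j)) = nu (inr j).
  have /matrixP/(_ j 0) := nuG; rewrite dlp_combinationE mxE big1 => [|i _].
    by move=> /eqP; rewrite add0r addrC subr_eq0 => /eqP.
  by rewrite nu0 mulr0.
have nur j : nu (inr j) = 0.
  have [xj|xj] := eqVneq (x j 0) 1; last first.
    by apply: nus; rewrite finset.in_set.
  rewrite -nuj; apply: nus; rewrite finset.in_set xj; exact: oner_neq0.
by move=> [[i|j]|j]; rewrite ?nuj.
Qed.

(** The optimum moves along vectors [u i] that shift the [i]-th resource row
    by one and leave the other binding rows fixed; since the binding set does
    not change, a multiplier of [x] remains one for the moved point. *)
Lemma independent_binding_primal_stability :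
  independent_binding -> discrete_primal_stability a r p d.
Proof.
move=> indep; exists x; split=> //.
have [u uE] := choice (fun i => dual_vector (inl (inl i)) indep).
pose x' (d' : 'cV[R]_m) := x + \sum_i (d' i 0 - d i 0) *: u i.
have rhs_shift (d' : 'cV[R]_m) c :
    dlp_rhs d' c = dlp_rhs d c + \sum_i (d' i 0 - d i 0) * (c == inl (inl i))%:R.
  case: c => [[i|j]|j] /=; last 2 first.
  - by rewrite big1 ?addr0 // => i _; rewrite mulr0.
  - by rewrite big1 ?addr0 // => i _; rewrite mulr0.
  rewrite (bigD1 i) //= eqxx mulr1 big1 ?addr0 => [|k /negPf ki].
    by rewrite addrC subrK.
  have -> : (inl (inl i) == inl (inl k) :> 'I_m + 'I_n + 'I_n) = (k == i).
    by rewrite eq_sym.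
  by rewrite ki mulr0.
have dot_x' d' c : dot (dlp_row c) (x' d') =
    dot (dlp_row c) x + \sum_i (d' i 0 - d i 0) * dot (dlp_row c) (u i).
  by rewrite dotDr dot_sumr; under eq_bigr => i _ do rewrite dotZr.
have tight d' c : c \in dlp_binding a p d x ->
    dot (dlp_row c) (x' d') = dlp_rhs d' c.
  move=> cx; rewrite dot_x' rhs_shift; congr (_ + _).
    by move: cx; rewrite dlp_bindingE finset.in_set => /eqP.
  by apply: eq_bigr => i _; rewrite uE.
have : \forall d' \near d, forall c, c \notin dlp_binding a p d x ->
    dot (dlp_row c) (x' d') < dlp_rhs d' c.
  apply: (@filter_forall 'cV[R]_m _ (fun c d' => c \notin dlp_binding a p d x ->
    dot (dlp_row c) (x' d') < dlp_rhs d' c) _ (nbhs_filter d)) => c.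
  have [cx|cx] := boolP (c \in dlp_binding a p d x); first by apply: nearW.
  have gap : 0 < dlp_rhs d c - dot (dlp_row c) x.
    have /dlp_optimalE[/(_ c) fx _] := ox.
    rewrite subr_gt0 lt_neqAle fx andbT.
    by move: cx; rewrite dlp_bindingE finset.in_set.
  have := near_affine_gt0 d
    (fun i => (c == inl (inl i))%:R - dot (dlp_row c) (u i)) gap.
  apply: filterS => d' gap' _; rewrite -subr_gt0 dot_x' rhs_shift.
  apply: lt_le_trans gap' _; rewrite le_eqVlt; apply/orP; left; apply/eqP.
  under eq_bigr => i _ do rewrite mulrBr.
  by rewrite sumrB; ring.
apply: filterS => d' slack; exists (x' d').
have binding : active dlp_row (dlp_rhs d') (x' d') = dlp_binding a p d x.
  apply/setP => c; rewrite finset.in_set.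
  have [/tight ->|/slack /lt_eqF //] := boolP (c \in dlp_binding a p d x).
  exact: eqxx.
split; last by rewrite dlp_bindingE.
have [y [y0 ys yw]] := optimal_multiplier lp_unique.1.
apply/dlp_optimalE/(@multiplier_optimal _ _ _ _ _ _ _ y).
  move=> c; have [/tight ->//|/slack/ltW//] := boolP (c \in dlp_binding a p d x).
by split=> // c; rewrite binding dlp_bindingE; exact: ys.
Qed.

(** Independence makes the multiplier unique, hence positive on all binding
    rows, while multipliers always vanish on the other rows. *)
Lemma independent_binding_strict_complementarity :
  independent_binding -> strict_complementary_slackness a r p d.
Proof.
rewrite /independent_binding dlp_bindingE => indep.
have [y my] := optimal_multiplier lp_unique.1.
have yE := dlp_multiplierE my; set lambda := \col_i _ in yE.
have ml : multiplier dlp_row (dlp_rhs d) dlp_cost x (dlp_multiplier lambda).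
  by rewrite (_ : dlp_multiplier lambda = y) //; apply/funext => c; rewrite yE.
exists lambda; split.
  split=> [|mu]; first exact/(dual_optimalE _ ox).
  move=> /(dual_optimalE _ ox) mmu; apply/matrixP => i j; rewrite ord1.
  exact: (independent_multiplier indep ml mmu (inl (inl i))).
have strict c : (dlp_rhs d c - dot (dlp_row c) x == 0) (+)
    (dlp_multiplier lambda c == 0).
  have -> : (dlp_rhs d c - dot (dlp_row c) x == 0) =
      (c \in active dlp_row (dlp_rhs d) x).
    by rewrite finset.in_set subr_eq0 eq_sym.
  have [_ ms _] := ml.
  have [cx|/ms ->] := boolP (c \in active dlp_row (dlp_rhs d) x); last first.
    by rewrite eqxx.
  rewrite gt_eqF //; apply: (unique_multiplier_gt0 lp_unique) cx => y' my'.
  exact: independent_multiplier indep my' ml.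
exists x; split=> //; split; last split.
- by move=> i; have := strict (inl (inl i)); rewrite dot_resource.
- by move=> j; have := strict (inr j); rewrite dot_upper.
- by move=> j; have := strict (inl (inr j)); rewrite dot_lower /= opprK add0r.
Qed.

Lemma dual_uniqueness_independent_binding :
  dual_uniqueness a r p d -> independent_binding.
Proof.
move=> [lambda [ol ul]]; rewrite /independent_binding dlp_bindingE.
have ml := (dual_optimalE lambda ox).1 ol.
apply: (unique_multiplier_independent lp_unique ml) => y my c.
have yE := dlp_multiplierE my; rewrite yE; congr (dlp_multiplier _ c).
symmetry; apply: ul; apply/(dual_optimalE _ ox).
by rewrite (_ : dlp_multiplier _ = y) //; apply/funext => c'; rewrite yE.
Qed.

Lemma card_dlp_binding :
  #|dlp_binding a p d x| =
  addn #|[set j | (x j 0 == 0) || (x j 0 == 1)]%SET|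
       #|[set i | dlp_usage a p x i == d i 0]%SET|.
Proof.
rewrite -!sum1dep_card !big_sumType /= [RHS]addnC -addnA; congr addn.
transitivity (\sum_(j < n) ((x j 0%R == 0%R) + (x j 0%R == 1%R)))%N.
  rewrite [RHS]big_split /=.
  by congr addn; rewrite big_mkcond; apply: eq_bigr => j _; case: (_ == _).
rewrite [RHS]big_mkcond; apply: eq_bigr => j _.
have [->|_] := eqVneq (x j 0) 0; first by rewrite eq_sym oner_eq0.
by case: (_ == _).
Qed.

Lemma independent_binding_nondegeneracy :
  independent_binding <-> dlp_nondegeneracy a r p d.
Proof.
rewrite /independent_binding independent_card; last first.
  by rewrite dlp_bindingE; exact: unique_spanning lp_unique.
rewrite card_dlp_binding; split=> [cardx|[x1 [/x_unique.2 <-]] //].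
by exists x.
Qed.

End UniqueOptimum.
End DLP.

Theorem lemma4p3 (R : realType) (m n : nat)
    (a : 'I_n -> 'cV[R]_m) (r p : 'I_n -> R) (d : 'cV[R]_m)
    (a_ge0 : forall j i, 0 <= a j i 0)
    (r_ge0 : forall j, 0 <= r j)
    (p_gt0 : forall j, 0 < p j)
    (p_sum1 : \sum_j p j = 1)
    (d_ge0 : forall i, 0 <= d i 0)
    (dlp_unique : exists! x : 'cV[R]_n, dlp_optimal a r p d x) :
  [<-> discrete_primal_stability a r p d;
       strict_complementary_slackness a r p d;
       dual_uniqueness a r p d;
       dlp_nondegeneracy a r p d].
Proof.
case: dlp_unique => x x_unique.
tfae.
- move=> /(primal_stability_independent_binding x_unique).
  exact: independent_binding_strict_complementarity.
- by move=> [lambda [ul _]]; exists lambda.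
- move=> /(dual_uniqueness_independent_binding p_gt0 x_unique).
  by move/(independent_binding_nondegeneracy x_unique).
- move=> /(independent_binding_nondegeneracy x_unique).
  exact: independent_binding_primal_stability.
Qed.
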